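(* Consider a reduced constrained pairwise covering problem on binary parameters $X_1,\dots,X_k$, let $\mathbf{M}\in\{0,1\}^{N\times k}$ be any valid covering array for it with $N$ tests, let $i\neq j$, and let $w_i$ and $w_j$ be the numbers of ones in the columns of $\mathbf{M}$ associated with $X_i$ and $X_j$. Then: - if the problem is subject to $(X_i,X_j)\neq(0,0)$, then $w_i+w_j\geq N+1$; - if the problem is subject to $(X_i,X_j)\neq(0,1)$, then $w_i-w_j\geq 1$; - if the problem is subject to $(X_i,X_j)\neq(1,0)$, then $w_j-w_i\geq 1$; - if the problem is subject to $(X_i,X_j)\neq(1,1)$, then $w_i+w_j\leq N-1$.
   Context: A constrained pairwise covering problem consists of binary parameters $X_1,\dots,X_k$ and a set of pairwise constraints, each of the form $(X_i,X_j)\neq(\alpha,\beta)$ with $i\neq j$ and $\alpha,\beta\in\{0,1\}$. An assignment $x\in\{0,1\}^k$ is feasible if it satisfies all constraints. A pairwise assignment $(X_i,X_j)=(\alpha,\beta)$ is forbidden if no feasible $x$ has $(x_i,x_j)=(\alpha,\beta)$, i.e., if the constraint $(X_i,X_j)\neq(\alpha,\beta)$ is explicitly given or implied by the other constraints; in either case the problem is said to be subject to $(X_i,X_j)\neq(\alpha,\beta)$. The problem is reduced if (i) no parameter has a fixed value (explicitly or by implication), i.e., each $X_i$ takes both values among feasible assignments, and (ii) there is at most one pairwise constraint (explicit or implied) per pair of parameters. A valid covering array with $N$ tests is a matrix $\mathbf{M}\in\{0,1\}^{N\times k}$ (rows are tests, column $i$ gives the values of $X_i$) in which every row is feasible and,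 for every pair $i\neq j$ and every $(\alpha,\beta)\in\{0,1\}^2$ such that $(X_i,X_j)=(\alpha,\beta)$ is not forbidden, some row has value $\alpha$ in column $i$ and value $\beta$ in column $j$. *)

(* Defs.v *)
From mathcomp Require Import all_boot all_algebra.

Set Implicit Arguments.
Unset Strict Implicit.
Unset Printing Implicit Defensive.

(* [((i, a), (j, b))] encodes the constraint (X_i, X_j) <> (a, b); the values
   0 and 1 are [false] and [true]. *)
Definition constraint (k : nat) : Type := (('I_k * bool) * ('I_k * bool))%type.

Record problem (k : nat) : Type := Problem {
  constraints : seq (constraint k);
  constraints_distinct : forall c, c \in constraints -> c.1.1 != c.2.1
}.

Definition takes (k : nat) (x : 'rV[bool]_k) (i j : 'I_k) (a b : bool) : bool :=
  (x ord0 i == a) && (x ord0 j == b).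

Definition feasible (k : nat) (P : problem k) (x : 'rV[bool]_k) : bool :=
  all (fun c => ~~ takes x c.1.1 c.2.1 c.1.2 c.2.2) (constraints P).

Definition forbidden (k : nat) (P : problem k) (i j : 'I_k) (a b : bool) : Prop :=
  ~ exists x : 'rV[bool]_k, feasible P x /\ takes x i j a b.

(* A constraint is explicit or implied exactly when the pairwise assignment
   it excludes is forbidden. *)
Definition subject_to (k : nat) (P : problem k) (i j : 'I_k) (a b : bool) : Prop :=
  forbidden P i j a b.

(* In the second clause, [subject_to P i j a b] and [subject_to P j i b a]
   express the same constraint, so fixing one order of the pair loses
   nothing. *)
Definition reduced (k : nat) (P : problem k) : Prop :=
  (forall (i : 'I_k) (a : bool),
     exists x : 'rV[bool]_k, feasible P x /\ x ord0 i = a) /\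
  (forall (i j : 'I_k) (a b a' b' : bool), i != j ->
     subject_to P i j a b -> subject_to P i j a' b' -> (a, b) = (a', b')).

Definition valid_covering_array (k N : nat) (P : problem k)
    (M : 'M[bool]_(N, k)) : Prop :=
  (forall r : 'I_N, feasible P (row r M)) /\
  (forall (i j : 'I_k) (a b : bool), i != j -> ~ forbidden P i j a b ->
     exists r : 'I_N, M r i = a /\ M r j = b).

Definition weight (N k : nat) (M : 'M[bool]_(N, k)) (i : 'I_k) : nat :=
  #|[set r : 'I_N | M r i]|.

(* Main.v *)
Require Import Defs.
From mathcomp Require Import all_boot all_order all_algebra.
From mathcomp Require Import zify.
Import Order.TTheory GRing.Theory Num.Theory.
Local Open Scope ring_scope.

Set Implicit Arguments.
Unset Strict Implicit.

(** Suppose that (X_i, X_j) <> (a, b).  Every test is feasible, so a test in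
    which X_i is a has X_j equal to ~~ b.  This inclusion between sets of tests
    is strict: the pair carries at most one constraint, so the opposite
    assignment (~~ a, ~~ b) is not forbidden, and the array must contain a test
    that covers it; there X_j is ~~ b while X_i is not a.  Comparing cardinals
    ([subject_to_card_ltn]) gives one strict inequality between the number of
    a's in column i and the number of ~~ b's in column j.  A column has w ones
    and N - w zeros, so the four choices of (a, b) turn this inequality into
    the four bounds. *)

Definition tests_with (k N : nat) (M : 'M[bool]_(N, k)) (i : 'I_k) (a : bool) :
  {set 'I_N} := [set r | M r i == a].

Lemma card_tests_true (k N : nat) (M : 'M[bool]_(N, k)) (i : 'I_k) :
  #|tests_with M i true| = weight M i.
Proof. by apply: eq_card => r; rewrite !inE eqb_id. Qed.

Lemma card_tests_false (k N : nat) (M : 'M[bool]_(N, k)) (i : 'I_k) :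
  (#|tests_with M i false| + weight M i)%N = N.
Proof.
rewrite -card_tests_true addnC -[RHS]card_ord -(cardsC (tests_with M i true)).
by congr addn; apply: eq_card => r; rewrite !inE; case: (M r i).
Qed.

Lemma valid_row_not_takes (k N : nat) (P : problem k) (M : 'M[bool]_(N, k))
    (i j : 'I_k) (a b : bool) (r : 'I_N) :
  valid_covering_array P M -> subject_to P i j a b ->
  ~~ ((M r i == a) && (M r j == b)).
Proof.
move=> [feasM _] sub_ab; apply/negP => takes_ab; apply: sub_ab.
by exists (row r M); split; [exact: feasM | rewrite /takes !mxE].
Qed.

(** With at most one constraint per pair, excluding an assignment makes the
    other three possible; the opposite one is the one that separates the two
    columns. *)
Lemma reduced_opposite_allowed (k : nat) (P : problem k) (i j : 'I_k)
    (a b : bool) :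
  reduced P -> i != j -> subject_to P i j a b ->
  ~ forbidden P i j (~~ a) (~~ b).
Proof.
move=> [_ one_constraint] neq_ij sub_ab sub_opp.
have [] := one_constraint i j a b _ _ neq_ij sub_ab sub_opp.
by case: (a).
Qed.

(** Inclusion comes from the feasibility of the tests, strictness from the
    coverage of the opposite assignment. *)
Lemma subject_to_card_ltn (k N : nat) (P : problem k) (M : 'M[bool]_(N, k))
    (i j : 'I_k) (a b : bool) :
  reduced P -> valid_covering_array P M -> i != j -> subject_to P i j a b ->
  (#|tests_with M i a| < #|tests_with M j (~~ b)|)%N.
Proof.
move=> redP validM neq_ij sub_ab; apply: proper_card; apply/properP; split.
  apply/subsetP => r; rewrite !inE => ri_a.
  have := valid_row_not_takes r validM sub_ab.
  by rewrite ri_a; case: (M r j); case: (b).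
have [r [ri rj]] :=
  validM.2 i j _ _ neq_ij (reduced_opposite_allowed redP neq_ij sub_ab).
by exists r; rewrite !inE ?rj ?ri //; case: (a).
Qed.

Unset Implicit Arguments.

Theorem theorem1 (k N : nat) (P : problem k) (M : 'M[bool]_(N, k)) (i j : 'I_k)
    (P_reduced : reduced P) (M_valid : valid_covering_array P M)
    (neq_ij : i != j) :
  let w_i : int := (weight M i)%:Z in
  let w_j : int := (weight M j)%:Z in
  (subject_to P i j false false -> w_i + w_j >= N%:Z + 1) /\
  (subject_to P i j false true -> w_i - w_j >= 1) /\
  (subject_to P i j true false -> w_j - w_i >= 1) /\
  (subject_to P i j true true -> w_i + w_j <= N%:Z - 1).
Proof.
move=> w_i w_j; rewrite /w_i /w_j.
have := card_tests_false M i; have := card_tests_false M j.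
have ltn_tests a b :=
  @subject_to_card_ltn k N P M i j a b P_reduced M_valid neq_ij.
move: (ltn_tests false false) (ltn_tests false true).
move: (ltn_tests true false) (ltn_tests true true).
rewrite !card_tests_true.
move: #|tests_with M i false| #|tests_with M j false| => z_i z_j.
move=> lt10 lt11 lt00 lt01 Nj Ni.
by do !split; [move/lt00 | move/lt01 | move/lt10 | move/lt11]; lia.
Qed.
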